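(* Let $X$ be a Peano space that is a small loop transfer space, and let $x_0\in X$. Then $\pi_1^{wh}(X,x_0)=\pi_1^{top}(X,x_0)$ (the two topologies on $\pi_1(X,x_0)$ coincide) and $\widetilde X_{top}=\widetilde X_{wh}$ (the two topologies on $\widetilde X$ coincide).
   Context: A (topological) Peano space is a connected and locally path-connected topological space. Let $I=[0,1]$. $\widetilde X$ is the set of homotopy classes $[\alpha]$ (rel. end-points) of paths $\alpha\colon I\to X$ with $\alpha(0)=x_0$; $\pi_1(X,x_0)$ is regarded as the subset of classes of loops. $\widetilde X_{top}$ is $\widetilde X$ with the quotient topology from the space $(X,x_0)^{(I,0)}$ of paths starting at $x_0$ with the compact-open topology; $\pi_1^{top}(X,x_0)$ is $\pi_1(X,x_0)$ with the quotient topology from the loop space $(X,x_0)^{(S^1,1)}$ with the compact-open topology. $\widetilde X_{wh}$ is $\widetilde X$ with the whisker topology, which has basis $B([\alpha],U)=\{[\alpha\ast\beta]\}$, where $\alpha$ is a path in $X$ from $x_0$ to $x_1$, $U$ is a neighborhood of $x_1$ in $X$, and $\beta$ ranges over paths in $U$ originating at $x_1$; $\pi_1^{wh}(X,x_0)$ is $\pi_1(X,x_0)$ with the subspace topology from $\widetilde X_{wh}$. A topological space $X$ is a small loop transfer space (SLT-space) if for every path $\alpha$ in $X$ and every neighborhood $U$ of $\alpha(0)$ there is a neighborhood $V$ of $\alpha(1)$ such that given a loop $\beta\colon(S^1,1)\to(V,\alpha(1))$ there is a loop $\gamma\colon(S^1,1)\to(U,\alpha(0))$ that is homotopic in $X$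 to $\alpha\ast\beta\ast\alpha^{-1}$ rel. $\alpha(0)$. *)

(* Defs.v *)
From HB Require Import structures.
From mathcomp Require Import all_boot all_order all_algebra generic_quotient.
From mathcomp Require Import all_classical all_reals all_analysis.
From mathcomp Require Import lra homotopy.

Set Implicit Arguments.
Unset Strict Implicit.
Unset Printing Implicit Defensive.

Import Order.TTheory GRing.Theory Num.Theory.
Import numFieldNormedType.Exports.

Local Open Scope classical_set_scope.
Local Open Scope ring_scope.
Local Open Scope quotient_scope.

Definition unit_interval (R : realType) : Type := `[0 : R, 1]%classic.

HB.instance Definition _ (R : realType) :=
  Topological.copy (unit_interval R) (set_type `[0 : R, 1]%classic).

Section unit_interval.
Context {R : realType}.
Notation I := (unit_interval R).

Definition ival (t : I) : R := \val t.

Lemma clamp_subproof (r : R) :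
  Num.max 0 (Num.min r 1) \in `[0 : R, 1]%classic.
Proof.
by apply/mem_set; rewrite /= in_itv /= le_max lexx ge_max ler01 ge_min lexx orbT.
Qed.

(* The retraction of R onto [0, 1]; it is the identity on [0, 1]. *)
Definition clamp (r : R) : I :=
  exist (fun x => x \in `[0 : R, 1]%classic) _ (clamp_subproof r).

Lemma ival_ge0 (t : I) : 0 <= ival t.
Proof. by have /set_mem := svalP t; rewrite /= in_itv /= => /andP[]. Qed.

Lemma ival_le1 (t : I) : ival t <= 1.
Proof. by have /set_mem := svalP t; rewrite /= in_itv /= => /andP[]. Qed.

Lemma ival_inj : injective ival.
Proof. exact: val_inj. Qed.

Lemma clampK (r : R) : 0 <= r <= 1 -> ival (clamp r) = r.
Proof. by move=> /andP[r0 r1]; rewrite /ival /= (min_l r1) max_r. Qed.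

Lemma clamp_le0 (r : R) : r <= 0 -> clamp r = clamp 0.
Proof.
move=> r0; apply: ival_inj; rewrite /ival /= min_l; last exact: le_trans r0 ler01.
by rewrite max_l // min_l ?ler01 // max_l.
Qed.

Lemma clamp_ge1 (r : R) : 1 <= r -> clamp r = clamp 1.
Proof. by move=> r1; apply: ival_inj; rewrite /ival /= !min_r. Qed.

Lemma ivalK (t : I) : clamp (ival t) = t.
Proof. by apply: ival_inj; rewrite clampK // ival_ge0 ival_le1. Qed.

Lemma ival_continuous : continuous ival.
Proof. exact: initial_continuous. Qed.

Lemma clamp_continuous : continuous clamp.
Proof.
apply/(@continuous_comp_initial _ _ _ set_val) => r.
apply: (@continuous_max R _ (cst 0) (fun r : R => Num.min r 1)).
  exact: cst_continuous.
by apply: (@continuous_min R _ id (cst 1)); [exact: cvg_id|exact: cst_continuous].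
Qed.

Lemma clamp01_neq : clamp 0 != clamp 1.
Proof.
apply/eqP => /(congr1 ival); rewrite !clampK ?lexx ?ler01 //.
by move/eqP; rewrite eq_sym oner_eq0.
Qed.

HB.instance Definition _ := @isBiPointed.Build I (clamp 0) (clamp 1) clamp01_neq.

Lemma ival0 : ival zero = 0.
Proof. by rewrite clampK // lexx ler01. Qed.

Lemma ival1 : ival one = 1.
Proof. by rewrite clampK // lexx ler01. Qed.

End unit_interval.

Section concatenation.
Context {R : realType} {X : topologicalType}.
Notation I := (unit_interval R).

Definition concat (f g : I -> X) : I -> X := fun t =>
  if ival t <= 2^-1 then f (clamp (2 * ival t)) else g (clamp (2 * ival t - 1)).

Definition path_rev (f : I -> X) : I -> X := fun t => f (clamp (1 - ival t)).

Lemma paste_continuous (Z Y : topologicalType) (A : Z -> R) (f g : Z -> Y) :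
  continuous A -> continuous f -> continuous g ->
  (forall z, A z = 2^-1 -> f z = g z) ->
  continuous (fun z => if A z <= 2^-1 then f z else g z).
Proof.
move=> cA cf cg fg z W /=; have [Az|Az|Az] := ltgtP (A z) 2^-1 => HW.
- have nA : \forall y \near z, A y < 2^-1.
    exact: (cA z _ (open_nbhs_nbhs (conj (@open_lt R 2^-1) Az))).
  change (\forall y \near z, W (if A y <= 2^-1 then f y else g y)); near=> y; have -> : A y <= 2^-1 by apply: ltW; near: y.
  by near: y; exact: cf.
- have nA : \forall y \near z, A y > 2^-1.
    exact: (cA z _ (open_nbhs_nbhs (conj (@open_gt R 2^-1) Az))).
  change (\forall y \near z, W (if A y <= 2^-1 then f y else g y)); near=> y; rewrite leNgt.
  have -> : 2^-1 < A y by near: y.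
  by near: y; exact: cg.
- change (\forall y \near z, W (if A y <= 2^-1 then f y else g y)); near=> y; case: ifP => _; near: y; first exact: cf.
  by apply: cg; rewrite -fg.
Unshelve. all: by end_near. Qed.

Lemma affine_continuous (a b : R) :
  continuous (fun t : I => a * ival t + b : R).
Proof.
move=> t.
apply: (@continuousD R R^o I (fun t => a * ival t) (cst b) t);
  last exact: cst_continuous.
apply: (@continuousM R I (cst a) ival t); first exact: cst_continuous.
exact: ival_continuous.
Qed.

Lemma affine_clamp_continuous (a b : R) :
  continuous (fun t : I => clamp (a * ival t + b)).
Proof.
move=> t; apply: (@continuous_comp I R I (fun t => a * ival t + b) clamp);
  last exact: clamp_continuous.
exact: affine_continuous.
Qed.

Lemma pair_continuous (Z Y Y' : topologicalType) (f : Z -> Y) (g : Z -> Y') z :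
  {for z, continuous f} -> {for z, continuous g} ->
  {for z, continuous (fun z => (f z, g z))}.
Proof. by move=> cf cg; apply: cvg_pair. Qed.

Lemma concat_continuous (f g : I -> X) : continuous f -> continuous g ->
  f one = g zero -> continuous (concat f g).
Proof.
move=> cf cg fg; apply: paste_continuous.
- exact: ival_continuous.
- move=> t; apply: continuous_comp; last exact: cf.
  by have := @affine_clamp_continuous 2 0 t; under eq_fun do rewrite addr0.
- move=> t; apply: continuous_comp; last exact: cg.
  exact: (@affine_clamp_continuous 2 (-1) t).
- by move=> t ->; rewrite divff // subrr.
Qed.

Lemma concat0 (f g : I -> X) : concat f g zero = f zero.
Proof. by rewrite /concat ival0 invr_ge0 ler0n mulr0. Qed.

Lemma concat1 (f g : I -> X) : concat f g one = g one.
Proof.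
rewrite /concat ival1 ifF; last by apply/negbTE; rewrite -ltNge; lra.
by rewrite mulr1; congr (g (clamp _)); lra.
Qed.

End concatenation.

Section homotopy.
Context {R : realType} {X : topologicalType}.
Notation I := (unit_interval R).

(* Homotopy of paths relative to the end-points. *)
Definition path_homotopic (f g : I -> X) : Prop :=
  exists H : I * I -> X,
    [/\ continuous H,
        forall t, H (t, zero) = f t,
        forall t, H (t, one) = g t,
        forall s, H (zero, s) = f zero
      & forall s, H (one, s) = f one].

Lemma path_homotopic_refl (f : I -> X) : continuous f -> path_homotopic f f.
Proof.
move=> cf; exists (f \o fst); split=> // ts.
by apply: continuous_comp; [exact: cvg_fst|exact: cf].
Qed.

Lemma path_homotopic_ends (f g : I -> X) : path_homotopic f g ->
  f zero = g zero /\ f one = g one.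
Proof. by move=> [H [_ H0 H1 Hz Ho]]; rewrite -!H1 Hz Ho. Qed.

Lemma path_homotopic_sym (f g : I -> X) :
  path_homotopic f g -> path_homotopic g f.
Proof.
move=> fg; have [e0 e1] := path_homotopic_ends fg.
case: fg => H [cH H0 H1 Hz Ho].
exists (fun ts => H (ts.1, clamp (1 - ival ts.2))); split=> /=.
- move=> [t s]; apply: (@continuous_comp _ _ _
    (fun ts : I * I => (ts.1, clamp (1 - ival ts.2))) H); last exact: cH.
  apply: pair_continuous; first exact: cvg_fst.
  apply: (@continuous_comp _ _ _ snd (fun s => clamp (1 - ival s))).
    exact: cvg_snd.
  have := @affine_clamp_continuous R (-1) 1 s.
  by under eq_fun do rewrite mulN1r addrC.
- by move=> t; rewrite ival0 subr0 H1.
- by move=> t; rewrite ival1 subrr H0.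
- by move=> s; rewrite Hz.
- by move=> s; rewrite Ho.
Qed.

Lemma path_homotopic_trans (f g h : I -> X) :
  path_homotopic f g -> path_homotopic g h -> path_homotopic f h.
Proof.
move=> fg; have [e0 e1] := path_homotopic_ends fg.
case: fg => H [cH H0 H1 Hz Ho] [K [cK K0 K1 Kz Ko]].
exists (fun ts => concat (fun s => H (ts.1, s)) (fun s => K (ts.1, s)) ts.2).
split=> /=.
- apply: (@paste_continuous R _ _ (fun ts => ival ts.2)
    (fun ts => H (ts.1, clamp (2 * ival ts.2)))
    (fun ts => K (ts.1, clamp (2 * ival ts.2 - 1)))).
  + move=> ts; apply: (@continuous_comp _ _ _ snd ival); first exact: cvg_snd.
    exact: ival_continuous.
  + move=> [t s]; apply: (@continuous_comp _ _ _
      (fun ts : I * I => (ts.1, clamp (2 * ival ts.2))) H); last exact: cH.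
    apply: pair_continuous; first exact: cvg_fst.
    apply: (@continuous_comp _ _ _ snd (fun s => clamp (2 * ival s))).
      exact: cvg_snd.
    by have := @affine_clamp_continuous R 2 0 s; under eq_fun do rewrite addr0.
  + move=> [t s]; apply: (@continuous_comp _ _ _
      (fun ts : I * I => (ts.1, clamp (2 * ival ts.2 - 1))) K); last exact: cK.
    apply: pair_continuous; first exact: cvg_fst.
    apply: (@continuous_comp _ _ _ snd (fun s => clamp (2 * ival s - 1))).
      exact: cvg_snd.
    exact: (@affine_clamp_continuous R 2 (-1) s).
  + by move=> ts ->; rewrite divff // subrr H1 K0.
- by move=> t; rewrite concat0 H0.
- by move=> t; rewrite concat1 K1.
- by move=> s; rewrite /concat; case: ifP; rewrite ?Hz ?Kz.
- by move=> s; rewrite /concat; case: ifP; rewrite ?Ho ?Ko.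
Qed.

Lemma path_homotopic_reparam (f : I -> X) (phi : I -> I) :
  continuous f -> continuous phi -> phi zero = zero -> phi one = one ->
  path_homotopic (f \o phi) f.
Proof.
move=> cf cphi phi0 phi1.
pose h (ts : I * I) := (1 - ival ts.2) * ival (phi ts.1) + ival ts.2 * ival ts.1.
exists (fun ts => f (clamp (h ts))); split=> /=.
- move=> ts; apply: (@continuous_comp _ _ _ (clamp \o h) f); last exact: cf.
  apply: continuous_comp; last exact: clamp_continuous.
  have c1 : {for ts, continuous (fun ts : I * I => ival ts.1)}.
    by apply: (@continuous_comp _ _ _ fst ival); [exact: cvg_fst|
      exact: ival_continuous].
  have c2 : {for ts, continuous (fun ts : I * I => ival ts.2)}.
    by apply: (@continuous_comp _ _ _ snd ival); [exact: cvg_snd|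
      exact: ival_continuous].
  have c3 : {for ts, continuous (fun ts : I * I => ival (phi ts.1))}.
    apply: (@continuous_comp _ _ _ fst (ival \o phi)); first exact: cvg_fst.
    by apply: continuous_comp; [exact: cphi|exact: ival_continuous].
  apply: (@continuousD R R^o); last exact: continuousM.
  apply: continuousM => //; apply: (@continuousB R R^o) => //; exact: cst_continuous.
- by move=> t; rewrite /h /= ival0 subr0 mul1r mul0r addr0 ivalK.
- by move=> t; rewrite /h /= ival1 subrr mul1r mul0r add0r ivalK.
- by move=> s; rewrite /h /= phi0 ival0 !mulr0 addr0.
- by move=> s; rewrite /h /= phi1 ival1 !mulr1 subrK.
Qed.

Lemma path_homotopic_concatl (f f' g : I -> X) : continuous g ->
  f one = g zero -> path_homotopic f f' ->
  path_homotopic (concat f g) (concat f' g).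
Proof.
move=> cg fg [H [cH H0 H1 Hz Ho]].
exists (fun ts => concat (fun t => H (t, ts.2)) g ts.1); split=> /=.
- apply: (@paste_continuous R _ _ (fun ts => ival ts.1)
    (fun ts => H (clamp (2 * ival ts.1), ts.2))
    (fun ts => g (clamp (2 * ival ts.1 - 1)))).
  + move=> ts; apply: (@continuous_comp _ _ _ fst ival); first exact: cvg_fst.
    exact: ival_continuous.
  + move=> [t s]; apply: (@continuous_comp _ _ _
      (fun ts : I * I => (clamp (2 * ival ts.1), ts.2)) H); last exact: cH.
    apply: pair_continuous; last exact: cvg_snd.
    apply: (@continuous_comp _ _ _ fst (fun s => clamp (2 * ival s))).
      exact: cvg_fst.
    by have := @affine_clamp_continuous R 2 0 t; under eq_fun do rewrite addr0.
  + move=> [t s]; apply: (@continuous_comp _ _ _ fst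
      (fun t : I => g (clamp (2 * ival t - 1)))); first exact: cvg_fst.
    apply: (@continuous_comp _ _ _ (fun t : I => clamp (2 * ival t - 1)) g).
      exact: (@affine_clamp_continuous R 2 (-1) t).
    exact: cg.
  + by move=> ts ->; rewrite divff // subrr Ho.
- by move=> t; congr (concat _ g t); apply/funext => u; rewrite H0.
- by move=> t; congr (concat _ g t); apply/funext => u; rewrite H1.
- by move=> s; rewrite !concat0 Hz.
- by move=> s; rewrite !concat1.
Qed.

Lemma path_homotopic_assoc (f g h : I -> X) :
  continuous f -> continuous g -> continuous h ->
  f one = g zero -> g one = h zero ->
  path_homotopic (concat (concat f g) h) (concat f (concat g h)).
Proof.
move=> cf cg ch fg gh.
(* phi sends [0,1/4], [1/4,1/2], [1/2,1] affinely to [0,1/2], [1/2,3/4], [3/4,1] *)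
pose r (t : I) : R := Num.min (2 * ival t) (Num.min (ival t + 4^-1) (2^-1 * ival t + 2^-1)).
pose phi (t : I) : I := clamp (r t).
have -> : concat (concat f g) h = concat f (concat g h) \o phi.
  apply/funext => t /=.
  have t0 := ival_ge0 t; have t1 := ival_le1 t.
  have rE : ival (phi t) = r t.
    apply: clampK; rewrite /r !le_min !ge_min; apply/andP; split.
      by apply/and3P; split; lra.
    by apply/orP; right; apply/orP; right; lra.
  rewrite /concat rE /r.
  have [t2|t2] := leP (ival t) 2^-1.
    rewrite (clampK (r := 2 * ival t)); last by apply/andP; split; lra.
    have [t4|t4] := leP (2 * ival t) 2^-1.
      rewrite min_l; last by rewrite !le_min; apply/andP; split; lra.
      by rewrite t4.
    rewrite (min_l (y := 2^-1 * ival t + 2^-1)); last by lra.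
    rewrite min_r; last by lra.
    rewrite ifF; last by apply/negbTE; rewrite -ltNge; lra.
    rewrite (clampK (r := 2 * (ival t + 4^-1) - 1)); last by apply/andP; split; lra.
    rewrite ifT; last by lra.
    by congr (g (clamp _)); lra.
  rewrite (min_r (x := ival t + 4^-1)); last by lra.
  rewrite min_r; last by lra.
  rewrite ifF; last by apply/negbTE; rewrite -ltNge; lra.
  rewrite (clampK (r := 2 * (2^-1 * ival t + 2^-1) - 1)); last by apply/andP; split; lra.
  rewrite ifF; last by apply/negbTE; rewrite -ltNge; lra.
  by congr (h (clamp _)); lra.
apply: path_homotopic_reparam.
- by apply: concat_continuous => //; [exact: concat_continuous|rewrite concat0].
- move=> t; apply: (@continuous_comp _ _ _ r clamp); last exact: clamp_continuous.
  have r1E : (fun t : I => 2 * ival t) = (fun t => 2 * ival t + 0).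
    by apply/funext => u; rewrite addr0.
  have r2E : (fun t : I => ival t + 4^-1) = (fun t => 1 * ival t + 4^-1).
    by apply/funext => u; rewrite mul1r.
  apply: (@continuous_min R); first by rewrite r1E; exact: affine_continuous.
  apply: (@continuous_min R); last exact: affine_continuous.
  by rewrite r2E; exact: affine_continuous.
- apply: ival_inj; rewrite /phi /r !ival0 clampK ?min_l //; rewrite ?le_min ?mulr0 ?add0r; lra.
- apply: ival_inj; rewrite /phi /r !ival1 clampK ?min_r //; rewrite ?le_min ?mulr1 ; lra.
Qed.

Lemma path_homotopic_unitr (f : I -> X) : continuous f ->
  path_homotopic (concat f (cst (f one))) f.
Proof.
move=> cf; have -> : concat f (cst (f one)) = f \o (fun t => clamp (2 * ival t)).
  apply/funext => t; rewrite /concat /=; have [//|t2] := leP (ival t) 2^-1.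
  by rewrite clamp_ge1 //; lra.
apply: path_homotopic_reparam => //.
- move=> t; have := @affine_clamp_continuous R 2 0 t.
  by under eq_fun do rewrite addr0.
- by rewrite ival0 mulr0.
- by rewrite ival1 clamp_ge1 // mulr1 ler1n.
Qed.

End homotopy.

Section peano_and_slt.
Variables (R : realType) (X : topologicalType).
Notation I := (unit_interval R).

Definition path_connected (A : set X) : Prop :=
  forall x y, A x -> A y ->
    exists p : {path I from x to y in X}, range p `<=` A.

Definition locally_path_connected : Prop :=
  forall (x : X) (U : set X), nbhs x U ->
    exists V : set X, [/\ open_nbhs x V, V `<=` U & path_connected V].

Definition peano_space : Prop :=
  connected [set: X] /\ locally_path_connected.

Definition circle : Type :=
  [set z : R * R | z.1 ^+ 2 + z.2 ^+ 2 = 1]%classic.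

HB.instance Definition _ := Topological.copy circle
  (set_type [set z : R * R | z.1 ^+ 2 + z.2 ^+ 2 = 1]%classic).

Lemma circle_exp_subproof (t : R) :
  (cos (2 * pi * t), sin (2 * pi * t))
    \in [set z : R * R | z.1 ^+ 2 + z.2 ^+ 2 = 1]%classic.
Proof. by apply/mem_set; rewrite /= cos2Dsin2. Qed.

Definition circle_exp (t : I) : circle :=
  exist (fun z => z \in [set z : R * R | z.1 ^+ 2 + z.2 ^+ 2 = 1]%classic)
    _ (circle_exp_subproof (ival t)).

Lemma circle_base_subproof :
  (1, 0) \in [set z : R * R | z.1 ^+ 2 + z.2 ^+ 2 = 1]%classic.
Proof. by apply/mem_set; rewrite /= expr1n expr0n addr0. Qed.

Definition circle_base : circle :=
  exist (fun z => z \in [set z : R * R | z.1 ^+ 2 + z.2 ^+ 2 = 1]%classic)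
    _ circle_base_subproof.

Lemma circle_exp_zero : circle_exp zero = circle_base.
Proof. by apply: val_inj; rewrite /= ival0 mulr0 cos0 sin0. Qed.

Lemma circle_exp_one : circle_exp one = circle_base.
Proof.
by apply: val_inj; rewrite /= ival1 mulr1 (mulr_natl pi 2) cos2pi sin2pi.
Qed.

Lemma circle_exp_continuous : continuous circle_exp.
Proof.
apply/(@continuous_comp_initial _ _ _ set_val) => t.
apply: (@pair_continuous _ _ _ (fun t : I => cos (2 * pi * ival t))
  (fun t : I => sin (2 * pi * ival t))).
  apply: (@continuous_comp _ _ _ (fun t : I => 2 * pi * ival t) cos).
    apply: (@continuousM R I (cst (2 * pi)) ival t).
      exact: cst_continuous.
    exact: ival_continuous.
  exact: continuous_cos.
apply: (@continuous_comp _ _ _ (fun t : I => 2 * pi * ival t) sin).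
  apply: (@continuousM R I (cst (2 * pi)) ival t).
    exact: cst_continuous.
  exact: ival_continuous.
exact: continuous_sin.
Qed.

(* (X, x)^(S^1, 1) with the compact-open topology *)
Definition loop_space (x : X) : Type :=
  [set g : {compact-open, circle -> X} |
    continuous (g : circle -> X) /\ g circle_base = x]%classic.

HB.instance Definition _ (x : X) := Topological.copy (loop_space x)
  (set_type [set g : {compact-open, circle -> X} |
    continuous (g : circle -> X) /\ g circle_base = x]%classic).

Definition loop_fun (x : X) (g : loop_space x) : circle -> X := \val g.

Lemma loop_continuous (x : X) (g : loop_space x) : continuous (loop_fun g).
Proof. by have /set_mem[] := svalP g. Qed.

Lemma loop_base (x : X) (g : loop_space x) : loop_fun g circle_base = x.
Proof. by have /set_mem[] := svalP g. Qed.

Definition loop_path (x : X) (g : loop_space x) : I -> X :=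
  loop_fun g \o circle_exp.

Definition slt_space : Prop :=
  forall (x y : X) (alpha : {path I from x to y in X}) (U : set X),
    nbhs x U ->
    exists V : set X, nbhs y V /\
      forall beta : loop_space y, range (loop_fun beta) `<=` V ->
        exists gamma : loop_space x, range (loop_fun gamma) `<=` U /\
          path_homotopic (loop_path gamma)
            (concat (concat alpha (loop_path beta)) (path_rev alpha)).

End peano_and_slt.

Section path_classes.
Variables (R : realType) (X : topologicalType) (x0 : X).
Notation I := (unit_interval R).

(* (X, x0)^(I, 0) with the compact-open topology *)
Definition based_path : Type :=
  [set f : {compact-open, I -> X} |
    continuous (f : I -> X) /\ f zero = x0]%classic.

HB.instance Definition _ := Topological.copy based_path
  (set_type [set f : {compact-open, I -> X} |
    continuous (f : I -> X) /\ f zero = x0]%classic).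

Definition path_fun (a : based_path) : I -> X := \val a.

Lemma path_fun_continuous (a : based_path) : continuous (path_fun a).
Proof. by have /set_mem[] := svalP a. Qed.

Lemma path_fun0 (a : based_path) : path_fun a zero = x0.
Proof. by have /set_mem[] := svalP a. Qed.

Definition mk_based_path (f : I -> X) (cf : continuous f) (f0 : f zero = x0) :
    based_path :=
  exist (fun f => f \in [set f : {compact-open, I -> X} |
    continuous (f : I -> X) /\ f zero = x0]%classic) f (mem_set (conj cf f0)).

Lemma const_path_continuous : continuous (cst x0 : I -> X).
Proof. by move=> t; exact: cst_continuous. Qed.

Definition const_path : based_path :=
  mk_based_path const_path_continuous erefl.

HB.instance Definition _ := isPointed.Build based_path const_path.

Definition homotopicb (a b : based_path) : bool :=
  `[< path_homotopic (path_fun a) (path_fun b) >].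

Lemma homotopicb_refl : reflexive homotopicb.
Proof. by move=> a; apply/asboolP/path_homotopic_refl/path_fun_continuous. Qed.

Lemma homotopicb_sym : symmetric homotopicb.
Proof.
by move=> a b; apply/idP/idP => /asboolP ab; apply/asboolP/path_homotopic_sym.
Qed.

Lemma homotopicb_trans : transitive homotopicb.
Proof.
move=> b a c /asboolP ab /asboolP bc; apply/asboolP.
exact: path_homotopic_trans ab bc.
Qed.

Canonical homotopic_equiv :=
  EquivRel homotopicb homotopicb_refl homotopicb_sym homotopicb_trans.

Definition path_classes : Type := {eq_quot homotopic_equiv}.

HB.instance Definition _ :=
  Quotient.copy path_classes {eq_quot homotopic_equiv}.
HB.instance Definition _ :=
  Choice.copy path_classes {eq_quot homotopic_equiv}.

Definition path_class (a : based_path) : path_classes :=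
  \pi_{eq_quot homotopic_equiv} a.

Lemma path_class_eqP (a b : based_path) :
  path_class a = path_class b <-> path_homotopic (path_fun a) (path_fun b).
Proof.
split=> [/eqquotP/asboolP//|ab]; exact/eqquotP/asboolP.
Qed.

Definition path_classes_top : Type :=
  quotient_topology {eq_quot homotopic_equiv}.

HB.instance Definition _ := Topological.copy path_classes_top
  (quotient_topology {eq_quot homotopic_equiv}).

Lemma open_path_classes_top (W : set path_classes_top) :
  open W <-> open ((path_class : based_path -> path_classes_top) @^-1` W).
Proof. by []. Qed.

Section extend_path.
Variables (a : based_path) (y : X) (b : {path I from path_fun a one to y in X}).

Lemma extend_path_continuous : continuous (concat (path_fun a) b).
Proof.
apply: concat_continuous; [exact: path_fun_continuous|exact: cts_fun|].
by rewrite path_zero.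
Qed.

Lemma extend_path0 : concat (path_fun a) b zero = x0.
Proof. by rewrite concat0 path_fun0. Qed.

Definition extend_path : based_path :=
  mk_based_path extend_path_continuous extend_path0.

End extend_path.

(* B([a], U) = {[a * b] | b a path in U with b(0) = a(1)} *)
Definition whisker_ball (a : based_path) (U : set X) : set path_classes :=
  [set p | exists (y : X) (b : {path I from path_fun a one to y in X}),
    range b `<=` U /\ p = path_class (extend_path b)].

(* Neighborhoods are taken open: for a non-open U the set B([a], U) need not be
   open, so that the family would not be a basis. *)
Definition whisker_index : set (based_path * set X) :=
  [set aU | open_nbhs (path_fun aU.1 one) aU.2].

Lemma whisker_ball_refl (a : based_path) (U : set X) :
  U (path_fun a one) -> whisker_ball a U (path_class a).
Proof.
move=> Ua; exists (path_fun a one), (cst (path_fun a one)).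
split; first by move=> _ [t _ <-].
apply/path_class_eqP/path_homotopic_sym/path_homotopic_unitr.
exact: path_fun_continuous.
Qed.

Lemma whisker_ball_sub (a c : based_path) (U V : set X) :
  whisker_ball a U (path_class c) -> V `<=` U ->
  whisker_ball c V `<=` whisker_ball a U.
Proof.
move=> [y [b [bU /path_class_eqP cab]]] VU _ [z [d [dV ->]]].
have cd : path_fun c one = d zero by rewrite path_zero.
have cb : b one = d zero.
  by rewrite -cd (path_homotopic_ends cab).2; exact/esym/concat1.
have cbd : continuous (concat b d).
  by apply: concat_continuous => //; exact: cts_fun.
have bd0 : concat b d zero = path_fun a one by rewrite concat0 path_zero.
have bd1 : concat b d one = z by rewrite concat1 path_one.
exists z, (mk_path cbd bd0 bd1); split.
  move=> _ [t _ <-]; change (U (concat b d t)); rewrite /concat.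
  by case: ifP => _; [apply: bU|apply/VU/dV]; eexists.
apply/path_class_eqP; apply: path_homotopic_trans.
  apply: path_homotopic_concatl cab => //; exact: cts_fun.
apply: path_homotopic_assoc => //; [exact: path_fun_continuous|exact: cts_fun..|].
by rewrite path_zero.
Qed.

Lemma whisker_cover : \bigcup_(aU in whisker_index) whisker_ball aU.1 aU.2 = setT.
Proof.
apply/seteqP; split=> // p _; exists (repr p, setT); first exact: open_nbhsT.
have := @whisker_ball_refl (repr p) setT Logic.I.
by rewrite /path_class reprK.
Qed.

Lemma whisker_join (i j : based_path * set X) (p : path_classes) :
  whisker_index i -> whisker_index j ->
  whisker_ball i.1 i.2 p -> whisker_ball j.1 j.2 p ->
  exists k, [/\ whisker_index k, whisker_ball k.1 k.2 p &
    whisker_ball k.1 k.2 `<=`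
      whisker_ball i.1 i.2 `&` whisker_ball j.1 j.2].
Proof.
have pE : path_class (repr p) = p by rewrite /path_class reprK.
have ballE aU : whisker_ball aU.1 aU.2 p -> aU.2 (path_fun (repr p) one).
  move=> [y [b [bU]]]; rewrite -[X in X = _]pE.
  move=> /path_class_eqP/path_homotopic_ends[_ ->].
  by apply: bU; exists one => //; exact/esym/concat1.
move=> [oi _] [oj _] ip jp; exists (repr p, i.2 `&` j.2).
have ijp : (i.2 `&` j.2) (path_fun (repr p) one) by split; exact: ballE.
split=> /=.
- by split=> //; exact: openI.
- by have := whisker_ball_refl ijp; rewrite pE.
- rewrite -pE in ip jp; move=> q qB; split.
    by apply: (whisker_ball_sub ip) qB; exact: subIsetl.
  by apply: (whisker_ball_sub jp) qB; exact: subIsetr.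
Qed.

Definition path_classes_wh : Type := path_classes.

HB.instance Definition _ := Choice.copy path_classes_wh path_classes.
HB.instance Definition _ := isBaseTopological.Build path_classes_wh
  whisker_cover whisker_join.

Lemma open_path_classes_wh (W : set path_classes_wh) : open W <->
  forall p, W p -> exists a U,
    [/\ open_nbhs (path_fun a one) U, whisker_ball a U p
      & whisker_ball a U `<=` W].
Proof.
split=> [[D sD <-] p [[a U] DaU aUp]|WP].
  exists a, U; split=> //; first exact: (sD _ DaU).
  by move=> q aUq; exists (a, U).
exists [set aU | whisker_index aU /\ whisker_ball aU.1 aU.2 `<=` W].
  by move=> aU [].
apply/seteqP; split=> [p [aU [_ aUW]] /aUW//|p /WP[a [U [oU aUp aUW]]]].
by exists (a, U).
Qed.

Lemma loop_path_continuous (g : loop_space R x0) : continuous (loop_path g).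
Proof.
move=> t; apply: continuous_comp; first exact: circle_exp_continuous.
exact: loop_continuous.
Qed.

Lemma loop_path0 (g : loop_space R x0) : loop_path g zero = x0.
Proof. by rewrite /loop_path /= circle_exp_zero loop_base. Qed.

Definition loop_class (g : loop_space R x0) : path_classes :=
  path_class (mk_based_path (@loop_path_continuous g) (loop_path0 g)).

Definition pi1 : set path_classes := range loop_class.

Definition pi1_wh : Type := @set_type path_classes_wh pi1.

HB.instance Definition _ :=
  Topological.copy pi1_wh (@set_type path_classes_wh pi1).

Lemma open_pi1_wh (W : set pi1_wh) : open W <->
  exists2 A : set path_classes_wh, open A & W = set_val @^-1` A.
Proof.
split=> [[A oA <-]|[A oA ->]]; exists A => //.
Qed.

Definition to_pi1 (g : loop_space R x0) : pi1 :=
  exist (fun p => p \in pi1) (loop_class g) (mem_set (imageT loop_class g)).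

Definition pi1_repr (p : pi1) : loop_space R x0 :=
  sval (cid2 (set_mem (svalP p))).

Lemma pi1_reprK : cancel pi1_repr to_pi1.
Proof.
by move=> p; apply: val_inj; rewrite /= /pi1_repr; case: cid2.
Qed.

Definition pi1_quot : Type := pi1.

HB.instance Definition _ := isQuotient.Build (loop_space R x0) pi1_quot pi1_reprK.

Definition pi1_top : Type := quotient_topology pi1_quot.

HB.instance Definition _ := Topological.copy pi1_top
  (quotient_topology pi1_quot).

Lemma pi_pi1E (g : loop_space R x0) : \pi_pi1_quot g = to_pi1 g.
Proof. by rewrite pi.unlock. Qed.

Lemma open_pi1_top (W : set pi1_top) :
  open W <-> open ((to_pi1 : loop_space R x0 -> pi1_top) @^-1` W).
Proof.
change (open (\pi_pi1_quot @^-1` W) <-> open (to_pi1 @^-1` W)).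
by rewrite (funext pi_pi1E).
Qed.

End path_classes.

Arguments pi1 R {X} x0.
Arguments pi1_wh R {X} x0.
Arguments pi1_top R {X} x0.
Arguments path_classes R {X} x0.
Arguments path_classes_wh R {X} x0.
Arguments path_classes_top R {X} x0.

(* Main.v *)
Require Import Defs.
From mathcomp Require Import all_boot all_order all_algebra.
From mathcomp Require Import all_classical all_reals all_analysis.
From mathcomp Require Import lra homotopy.
From Corelib Require Import -(notations) Setoid Morphisms.

(** Both statements compare the whisker topology with a quotient of the
    compact-open topology.

    The quotient topology is coarser because short whiskers are small in the
    compact-open topology: the class of a is represented by a followed by a
    constant path, and a neighborhood of that path contains a followed by b for
    all b in a suitable neighborhood of the end of a (near_extend_path).

    The converse is where small loop transfer enters. Given a neighborhood U of
    the end of a, one must show that every path c near a is homotopic to a followed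
    by a path in U (extend_path_near). Cut [0, 1] into short pieces and join c to a
    by short paths at the cutting points. Each pair of corresponding pieces of a
    and c then bounds a small loop, which small loop transfer along the remaining
    part of a moves to a loop in U at the end of a. Composing all of them expresses
    c as a followed by loops in U and by the last short path, which is also in U.
    Local path-connectedness provides the short paths. Instead of cutting, the
    proof propagates a property of the time t from 0 to 1 by connectedness
    (tracked, tracked_step, tracked1). The neighborhood V at time t allowed by small
    loop transfer depends on t and U, which is why U is fixed throughout and the
    transferred loops are collected at the end of a.

    For the fundamental group, the loops of the quotient topology are maps on the
    circle. As the circle is the quotient of [0, 1] by its endpoints, and a
    Hausdorff one, the space of loops is the space of closed based paths
    (based_loop_continuous, near_mk_loop), and the two arguments above carry
    over. *)

Set Implicit Arguments.
Unset Strict Implicit.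
Unset Printing Implicit Defensive.

Import Order.TTheory GRing.Theory Num.Theory.
Import numFieldNormedType.Exports.

(** * The unit interval *)

Section Interval.
Local Open Scope classical_set_scope.
Local Open Scope ring_scope.
Context {R : realType}.
Notation I := (unit_interval R).

Lemma image_clamp : clamp @` `[0 : R, 1] = [set: I].
Proof.
apply/seteqP; split=> // t _; exists (ival t); last exact: ivalK.
by rewrite /= in_itv /= ival_ge0 ival_le1.
Qed.

Lemma unit_interval_compact : compact [set: I].
Proof.
rewrite -image_clamp; apply: continuous_compact; last exact: segment_compact.
exact/continuous_subspaceT/clamp_continuous.
Qed.

Lemma unit_interval_connected : connected [set: I].
Proof.
rewrite -image_clamp; apply: connected_continuous_connected.
  exact: segment_connected.
exact/continuous_subspaceT/clamp_continuous.
Qed.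

(** Induction along [0, 1]: such a P is locally constant, so connectedness
    spreads it from 0 to 1. This replaces the choice of a subdivision of [0, 1]
    by means of a Lebesgue number. *)
Lemma locally_constant_unit_interval (P : I -> Prop) :
  (forall t : I, exists J : set I, nbhs (t : I) J /\
     forall s s', J s -> J s' -> P s -> P s') ->
  P zero -> P one.
Proof.
move=> Ploc P0.
have oP : open [set t | P t].
  rewrite openE => t /= Pt; have [J [tJ PJ]] := Ploc t.
  by apply: (filterS _ tJ) => s Js; exact: PJ (nbhs_singleton tJ) Js Pt.
have oPC : open (~` [set t | P t]).
  rewrite openE => t /= nPt; have [J [tJ PJ]] := Ploc t.
  apply: (filterS _ tJ) => s Js /= Ps; apply: nPt.
  exact: PJ Js (nbhs_singleton tJ) Ps.
suff PT : [set t | P t] = setT by change ([set t | P t] one); rewrite PT.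
apply: unit_interval_connected; first by exists zero.
- by exists [set t | P t] => //; rewrite setTI.
- by exists [set t | P t]; [rewrite -openC|rewrite setTI].
Qed.

Definition lin (s t u : I) : I := clamp ((ival t - ival s) * ival u + ival s).

Lemma ival_lin (s t u : I) :
  ival (lin s t u) = (ival t - ival s) * ival u + ival s.
Proof.
apply: clampK.
have [s0 s1] := (ival_ge0 s, ival_le1 s); have [t0 t1] := (ival_ge0 t, ival_le1 t).
have [u0 u1] := (ival_ge0 u, ival_le1 u).
apply/andP; split; nra.
Qed.

Lemma lin_continuous (s t : I) : continuous (lin s t).
Proof. exact: affine_clamp_continuous. Qed.

Lemma lin0 (s t : I) : lin s t zero = s.
Proof. by rewrite /lin ival0 mulr0 add0r ivalK. Qed.

Lemma lin1 (s t : I) : lin s t one = t.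
Proof. by rewrite /lin ival1 mulr1 subrK ivalK. Qed.

Lemma lin01 : lin zero one = id.
Proof.
by apply/funext => u; rewrite /lin ival0 ival1 subr0 mul1r addr0 ivalK.
Qed.
End Interval.

(** * Homotopies of paths *)

Section Paths.
Local Open Scope classical_set_scope.
Local Open Scope ring_scope.
Context {R : realType} {X : topologicalType}.
Notation I := (unit_interval R).
Notation pth x y := {path I from x to y in X}.

(** Two ways of travelling inside [0, 1] are homotopic by the straight-line
    homotopy, and composing with f carries it to X. All relations below between
    pieces of a single path come from this. *)
Lemma path_homotopic_interval (f : I -> X) (phi psi : I -> I) :
  continuous f -> continuous phi -> continuous psi ->
  phi zero = psi zero -> phi one = psi one ->
  path_homotopic (f \o phi) (f \o psi).
Proof.
move=> cf cphi cpsi e0 e1.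
pose h (ts : I * I) := lin (phi ts.1) (psi ts.1) ts.2.
have cval (k : I * I -> I) : continuous k -> continuous (fun z => ival (k z)).
  by move=> ck z; apply: continuous_comp; [exact: ck|exact: ival_continuous].
have cphi1 : continuous (fun ts : I * I => ival (phi ts.1)).
  by apply: cval => ts; apply: continuous_comp; [exact: cvg_fst|exact: cphi].
have cpsi1 : continuous (fun ts : I * I => ival (psi ts.1)).
  by apply: cval => ts; apply: continuous_comp; [exact: cvg_fst|exact: cpsi].
have cs : continuous (fun ts : I * I => ival ts.2).
  by apply: cval => ts; exact: cvg_snd.
have ch : continuous h.
  move=> ts; apply: (@continuous_comp _ _ _ (fun ts => _ : R) clamp);
    last exact: clamp_continuous.
  apply: (@continuousD R R^o); last exact: cphi1.
  apply: continuousM; last exact: cs.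
  by apply: (@continuousB R R^o); [exact: cpsi1|exact: cphi1].
exists (f \o h); split=> /=.
- by move=> ts; apply: continuous_comp; [exact: ch|exact: cf].
- by move=> t; rewrite /h lin0.
- by move=> t; rewrite /h lin1.
- by move=> s; rewrite /h /= e0 /lin subrr mul0r add0r ivalK.
- by move=> s; rewrite /h /= e1 /lin subrr mul0r add0r ivalK.
Qed.

Lemma path_homotopic_concat (f f' g g' : I -> X) : f one = g zero ->
  path_homotopic f f' -> path_homotopic g g' ->
  path_homotopic (concat f g) (concat f' g').
Proof.
move=> fg [H [cH H0 H1 Hz Ho]] [K [cK K0 K1 Kz Ko]].
have half (b : R) (L : I * I -> X) : continuous L ->
    continuous (fun ts : I * I => L (clamp (2 * ival ts.1 + b), ts.2)).
  move=> cL [t s]; apply: (@continuous_comp _ _ _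
    (fun ts : I * I => (clamp (2 * ival ts.1 + b), ts.2)) L); last exact: cL.
  apply: pair_continuous; last exact: cvg_snd.
  apply: (@continuous_comp _ _ _ fst (fun t => clamp (2 * ival t + b))).
    exact: cvg_fst.
  exact: affine_clamp_continuous.
exists (fun ts => concat (fun t => H (t, ts.2)) (fun t => K (t, ts.2)) ts.1).
split=> /=.
- apply: (@paste_continuous R _ _ (fun ts => ival ts.1)
    (fun ts => H (clamp (2 * ival ts.1), ts.2))
    (fun ts => K (clamp (2 * ival ts.1 - 1), ts.2))).
  + by move=> ts; apply: continuous_comp; [exact: cvg_fst|exact: ival_continuous].
  + by have := half 0 H cH; under eq_fun do rewrite addr0.
  + exact: half.
  + by move=> ts ->; rewrite divff // subrr Ho fg Kz.
- by move=> t; rewrite /concat; case: ifP; rewrite ?H0 ?K0.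
- by move=> t; rewrite /concat; case: ifP; rewrite ?H1 ?K1.
- by move=> s; rewrite !concat0 Hz.
- by move=> s; rewrite !concat1 Ko.
Qed.

(** Concatenations of pieces of one path f are f after a path in [0, 1], which
    brings them within the reach of path_homotopic_interval. *)
Lemma concat_comp (f : I -> X) (phi psi : I -> I) :
  concat (f \o phi) (f \o psi) = f \o concat phi psi.
Proof. by apply/funext => t; rewrite /concat /=; case: ifP. Qed.

Lemma path_homotopic_unitl (f : I -> X) : continuous f ->
  path_homotopic (concat (cst (f zero)) f) f.
Proof.
move=> cf; rewrite -[X in concat _ X]/(f \o id) -[X in concat X _]/(f \o cst zero).
rewrite concat_comp; apply: path_homotopic_reparam => //.
- apply: concat_continuous => // t; [exact: cst_continuous|exact: cvg_id].
- by rewrite concat0.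
- by rewrite concat1.
Qed.

Lemma path_rev_continuous (f : I -> X) : continuous f -> continuous (path_rev f).
Proof.
move=> cf t; apply: continuous_comp; last exact: cf.
have := @affine_clamp_continuous R (-1) 1 t.
by under eq_fun do rewrite mulN1r addrC.
Qed.

Lemma path_rev0 (f : I -> X) : path_rev f zero = f one.
Proof. by rewrite /path_rev ival0 subr0. Qed.

Lemma path_rev1 (f : I -> X) : path_rev f one = f zero.
Proof. by rewrite /path_rev ival1 subrr. Qed.

(** Homotopy is restated on paths bundled with their endpoints, so that
    concatenation and reversal become total operations and the groupoid laws
    can be used as rewriting rules without side conditions. *)
Definition heq (x y : X) (p q : pth x y) : Prop := path_homotopic p q.

Definition pcomp x y z (p : pth x y) (q : pth y z) : pth x z :=
  mk_path (concat_continuous (@cts_fun _ _ p) (@cts_fun _ _ q)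
             (etrans path_one (esym path_zero)))
    (etrans (concat0 p q) path_zero) (etrans (concat1 p q) path_one).

Definition prev x y (p : pth x y) : pth y x :=
  mk_path (path_rev_continuous (@cts_fun _ _ p))
    (etrans (path_rev0 p) path_one) (etrans (path_rev1 p) path_zero).

(** The piece of f between the times s and t, run backwards when t < s. Allowing
    both orders spares a case distinction each time that pieces are joined. *)
Definition seg (f : I -> X) (cf : continuous f) (s t : I) : pth (f s) (f t) :=
  mk_path (fun u => continuous_comp (@lin_continuous R s t u) (cf _))
    (congr1 f (lin0 s t)) (congr1 f (lin1 s t)).
End Paths.

Declare Scope path_scope.
Local Notation "p =h q" := (heq p q) (at level 70, no associativity) : path_scope.
Local Notation "p * q" := (pcomp p q) : path_scope.
Local Notation "p ^-1" := (prev p) : path_scope.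

(** * The groupoid of homotopy classes of paths *)

Section Groupoid.
Local Open Scope classical_set_scope.
Local Open Scope ring_scope.
Local Open Scope path_scope.
Context {R : realType} {X : topologicalType}.
Notation I := (unit_interval R).
Notation pth x y := {path I from x to y in X}.

#[global] Instance heq_equivalence x y : Equivalence (@heq R X x y).
Proof.
split.
- by move=> p; apply: path_homotopic_refl; exact: cts_fun.
- by move=> p q; exact: path_homotopic_sym.
- by move=> p q r; exact: path_homotopic_trans.
Qed.

#[global] Instance pcomp_proper x y z :
  Proper (respectful (@heq R X x y)
    (respectful (@heq R X y z) (@heq R X x z))) (@pcomp R X x y z).
Proof.
move=> p p' pp' q q' qq'; apply: path_homotopic_concat pp' qq'.
by rewrite path_one path_zero.
Qed.

Local Notation idp x := (cst x : pth x x).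

Lemma pcompA w x y z (p : pth w x) (q : pth x y) (r : pth y z) :
  (p * q) * r =h p * (q * r).
Proof.
apply: (@path_homotopic_assoc R X p q r); [exact: cts_fun..| |];
  by rewrite path_one path_zero.
Qed.

Lemma pcomp1 x y (p : pth x y) : p * idp y =h p.
Proof.
have : path_homotopic (concat p (cst (p one))) p.
  exact/path_homotopic_unitr/cts_fun.
by rewrite path_one.
Qed.

Lemma pcomp_seg (f : I -> X) (cf : continuous f) s t u :
  seg cf s t * seg cf t u =h seg cf s u.
Proof.
change (path_homotopic (concat (f \o lin s t) (f \o lin t u)) (f \o lin s u)).
rewrite concat_comp.
apply: path_homotopic_interval => //; try exact: lin_continuous.
- apply: concat_continuous; [exact: lin_continuous..|].
  by rewrite lin0 lin1.
- by rewrite concat0 !lin0.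
- by rewrite concat1 !lin1.
Qed.

Lemma seg_refl (f : I -> X) (cf : continuous f) s : seg cf s s =h idp (f s).
Proof.
apply: (@path_homotopic_interval _ _ f (lin s s) (cst s)) => //.
- exact: lin_continuous.
- exact: cst_continuous.
- by rewrite lin0.
- by rewrite lin1.
Qed.

Lemma prev_seg (f : I -> X) (cf : continuous f) s t :
  (seg cf s t)^-1 =h seg cf t s.
Proof.
apply: (@path_homotopic_interval _ _ f (path_rev (lin s t)) (lin t s)) => //.
- exact/path_rev_continuous/lin_continuous.
- exact: lin_continuous.
- by rewrite path_rev0 lin1 lin0.
- by rewrite path_rev1 lin1 lin0.
Qed.

Lemma path_homotopic_backtrack (f : I -> X) (phi : I -> I) :
  continuous f -> continuous phi -> phi zero = phi one ->
  path_homotopic (f \o phi) (cst (f (phi zero))).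
Proof.
move=> cf cphi e01.
apply: (@path_homotopic_interval _ _ f phi (cst (phi zero))) => //.
by move=> t; exact: cst_continuous.
Qed.

Lemma pcompVp x y (p : pth x y) : p^-1 * p =h idp y.
Proof.
have cid : continuous (id : I -> I) by move=> t; exact: cvg_id.
have : path_homotopic (p \o concat (path_rev id) id) (cst (p one)).
  rewrite -[one in X in _ X](path_rev0 (id : I -> I)) -(concat0 _ (id : I -> I)).
  apply: path_homotopic_backtrack; first exact: cts_fun.
    apply: concat_continuous => //; first exact: path_rev_continuous.
    by rewrite path_rev1.
  by rewrite concat0 concat1 path_rev0.
by rewrite -concat_comp path_one.
Qed.

Lemma pcomppV x y (p : pth x y) : p * p^-1 =h idp x.
Proof.
have cid : continuous (id : I -> I) by move=> t; exact: cvg_id.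
have : path_homotopic (p \o concat id (path_rev id)) (cst (p zero)).
  rewrite -[zero in X in _ X](concat0 id (path_rev (id : I -> I))).
  apply: path_homotopic_backtrack; first exact: cts_fun.
    apply: concat_continuous => //; first exact: path_rev_continuous.
    by rewrite path_rev0.
  by rewrite concat0 concat1 path_rev1.
by rewrite -concat_comp path_zero.
Qed.

Lemma pcomp1p x y (p : pth x y) : idp x * p =h p.
Proof.
have : path_homotopic (concat (cst (p zero)) p) p.
  exact/path_homotopic_unitl/cts_fun.
by rewrite path_zero.
Qed.

Lemma pcompKp x y z (p : pth x y) (q : pth y z) : p^-1 * (p * q) =h q.
Proof.
rewrite -pcompA pcompVp; exact: pcomp1p.
Qed.

Lemma pcomp_segA (f : I -> X) (cf : continuous f) s t u x (q : pth (f u) x) :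
  seg cf s t * (seg cf t u * q) =h seg cf s u * q.
Proof. rewrite -pcompA pcomp_seg; reflexivity. Qed.

Lemma pcomp_seg_refl (f : I -> X) (cf : continuous f) s x (q : pth (f s) x) :
  seg cf s s * q =h q.
Proof. rewrite seg_refl; exact: pcomp1p. Qed.

Lemma range_pcomp x y z (p : pth x y) (q : pth y z) (A : set X) :
  range p `<=` A -> range q `<=` A -> range (p * q) `<=` A.
Proof.
move=> pA qA _ [t _ <-]; change (A (concat p q t)); rewrite /concat.
by case: ifP => _; [apply: pA|apply: qA]; eexists.
Qed.

Lemma range_prev x y (p : pth x y) (A : set X) :
  range p `<=` A -> range (p^-1) `<=` A.
Proof. by move=> pA _ [t _ <-]; apply: pA; exists (clamp (1 - ival t)). Qed.

End Groupoid.

(** * The circle as a quotient of the unit interval *)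

Section Circle.
Local Open Scope classical_set_scope.
Local Open Scope ring_scope.
Context {R : realType}.
Notation I := (unit_interval R).
Notation S1 := (circle R).

(** The angle of a point (x, y) is acos x on the upper half circle, and its
    reflection 2 pi - acos x on the lower half. *)
Lemma circle_exp_surj (z : S1) : exists t, circle_exp t = z.
Proof.
case: z => -[x y] zP; have /= xy1 := set_mem zP.
have pi0 : 0 < pi :> R by exact: pi_gt0.
have xB : -1 <= x <= 1 by apply/andP; split; nra.
have [a0 a1] := (acos_ge0 xB, acos_lepi xB).
have cosa : cos (acos x) = x by rewrite acosK // in_itv.
have sina : sin (acos x) = `|y|.
  by rewrite sin_acos // -sqrtr_sqr; congr Num.sqrt; lra.
have lift (th : R) : 0 <= th <= 2 * pi -> cos th = x -> sin th = y ->
    exists t : I, cos (2 * pi * ival t) = x /\ sin (2 * pi * ival t) = y.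
  move=> /andP[th0 th1] <- <-; exists (clamp (th / (2 * pi))).
  rewrite clampK; first by rewrite mulrC divfK // mulf_neq0 // gt_eqF.
  by rewrite divr_ge0 ?ler_pdivrMr ?mul1r //; lra.
suff [t [ct st]] : exists t : I, cos (2 * pi * ival t) = x /\
    sin (2 * pi * ival t) = y.
  by exists t; apply: val_inj; rewrite /= ct st.
have [y0|y0] := leP 0 y.
  by apply: (lift (acos x)); rewrite ?sina ?ger0_norm //; lra.
rewrite ltr0_norm // in sina.
apply: (lift (2 * pi - acos x)); first by lra.
  by rewrite cosB (mulr_natl pi 2) cos2pi sin2pi cosa mul1r mul0r addr0.
by rewrite sinB (mulr_natl pi 2) cos2pi sin2pi sina mul1r mul0r sub0r opprK.
Qed.

Lemma cos_eq1 (x : R) : 0 <= x <= 2 * pi -> cos x = 1 -> x = 0 \/ x = 2 * pi.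
Proof.
move=> /andP[x0 x1] cx.
have pi0 : 0 < pi :> R by exact: pi_gt0.
have [xpi|xpi] := leP x pi.
  left; apply: cos_inj; rewrite ?in_itv /= ?cx ?cos0 //; lra.
right; suff : 2 * pi - x = 0 by lra.
apply: cos_inj; rewrite ?in_itv /= ?cos0; [lra|lra|].
by rewrite cosB (mulr_natl pi 2) cos2pi sin2pi cx mul1r mul0r addr0.
Qed.

(** If the two angles have the same sine and cosine, then their difference has
    cosine 1. *)
Lemma circle_exp_eq_ends (s t : I) : ival s <= ival t ->
  circle_exp s = circle_exp t -> s = t \/ s = zero /\ t = one.
Proof.
move=> st /(congr1 val) /= [cst sst].
have pi0 : 0 < pi :> R by exact: pi_gt0.
have [s0 t1] := (ival_ge0 s, ival_le1 t).
have pi2 : 2 * pi != 0 :> R by rewrite mulf_neq0 // gt_eqF.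
have dB : 0 <= 2 * pi * (ival t - ival s) <= 2 * pi by apply/andP; split; nra.
have cd : cos (2 * pi * (ival t - ival s)) = 1.
  by rewrite mulrBr cosB cst sst -!expr2 cos2Dsin2.
have [/eqP|e] := cos_eq1 dB cd.
  by rewrite mulf_eq0 (negPf pi2) subr_eq0 /= => /eqP/ival_inj ->; left.
have ts : ival t - ival s = 1 by apply: (mulfI pi2); rewrite mulr1.
by right; split; apply: ival_inj; rewrite ?ival0 ?ival1; lra.
Qed.

Lemma circle_exp_fiber (T : Type) (f : I -> T) : f zero = f one ->
  forall s t, circle_exp s = circle_exp t -> f s = f t.
Proof.
move=> f01 s t est; have [st|/ltW ts] := leP (ival s) (ival t).
  by have [->|[-> ->]] := circle_exp_eq_ends st est.
by have [->|[-> ->]] := circle_exp_eq_ends ts (esym est).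
Qed.

Lemma circle_hausdorff : hausdorff_space S1.
Proof.
move=> p q pq; apply: val_inj.
apply: (@norm_hausdorff R (R * R)%type).
move=> A B pA qB; have := pq (\val @^-1` A) (\val @^-1` B).
have cv : continuous (\val : S1 -> R * R) by exact: initial_continuous.
by move=> /(_ (cv _ _ pA) (cv _ _ qB))[z [Az Bz]]; exists (\val z).
Qed.

(** The exponential map is closed, being continuous from a compact space to a
    Hausdorff one; hence the circle carries the quotient topology. *)
Lemma continuous_circle (Y : topologicalType) (g : S1 -> Y) :
  continuous (g \o @circle_exp R) -> continuous g.
Proof.
move=> cg; apply/continuous_closedP => C cC.
have -> : g @^-1` C = @circle_exp R @` ((g \o @circle_exp R) @^-1` C).
  apply/seteqP; split=> [z Cz|_ [t Ct <-] //].
  by have [t tz] := circle_exp_surj z; exists t => //=; rewrite tz.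
apply: compact_closed; first exact: circle_hausdorff.
apply: continuous_compact.
  exact/continuous_subspaceT/circle_exp_continuous.
apply: (subclosed_compact _ unit_interval_compact) => //.
by move/continuous_closedP : cg; exact.
Qed.

(** A discontinuous section of the exponential map: composing with it turns a
    closed path into a map on the circle, which is continuous because the circle
    is a quotient of [0, 1]. *)
Definition circle_arg (z : S1) : I := sval (cid (circle_exp_surj z)).

Lemma circle_argK : cancel circle_arg (@circle_exp R).
Proof. by move=> z; rewrite /circle_arg; case: cid. Qed.

Lemma comp_circle_arg (T : Type) (f : I -> T) : f zero = f one ->
  (f \o circle_arg) \o (@circle_exp R) = f.
Proof.
by move=> f01; apply/funext => t /=; apply: circle_exp_fiber; rewrite ?circle_argK.
Qed.
End Circle.

(** * Neighborhoods in the compact-open topology *)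

Section CompactOpen.
Local Open Scope classical_set_scope.

(** Convergence in a space of functions is tested on the subbasic sets of the
    maps that send a compact K into an open O. Continuity of maps between such
    spaces, and statements that all functions near f have a property, are proved
    below by presenting them as the convergence of a filter. *)
Lemma compact_open_sub_cvgP (T U : topologicalType)
    (A : set {compact-open, T -> U}) (F : set_system (set_type A))
    (f : set_type A) : Filter F ->
  F --> f <-> forall K O, compact K -> open O -> (\val f : T -> U) @` K `<=` O ->
    F [set g | (\val g : T -> U) @` K `<=` O].
Proof.
move=> FF; split=> [Ff K O cK oO fKO|FKO].
  have cv : continuous (\val : set_type A -> {compact-open, T -> U}).
    exact: initial_continuous.
  apply/Ff/(cv f [set g : {compact-open, T -> U} | g @` K `<=` O]).
  by apply: open_nbhs_nbhs; split => //; exact: compact_open_open.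
move=> W [_ [[B oB <-] Bf] BW]; apply: (filterS BW).
have : \val @ F --> (\val f : {compact-open, T -> U}).
  by apply/compact_open_cvgP => K O cK oO fKO; exact: FKO.
by apply; exact: open_nbhs_nbhs.
Qed.

End CompactOpen.

(** * Spaces of based paths and of loops *)

Section BasedPaths.
Local Open Scope classical_set_scope.
Context {R : realType} {X : topologicalType} {x0 : X}.
Notation I := (unit_interval R).
Notation S1 := (circle R).
Notation pth x y := {path I from x to y in X}.

Lemma near_path_fun (a : based_path R x0) (K : set I) (O : set X) :
  compact K -> open O -> path_fun a @` K `<=` O ->
  \forall c \near a, path_fun c @` K `<=` O.
Proof.
by move=> cK oO aKO; have /compact_open_sub_cvgP := @cvg_id _ (nbhs a); apply.
Qed.

(** A subbasic neighborhood of a * const given by K and O either restricts the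
    second half, and then O contains the end of a and the tail is free to move
    in O, or restricts only the first half, and then the tail is free. *)
Lemma near_extend_path (a : based_path R x0) (N : set (based_path R x0)) :
  nbhs (extend_path (cst (path_fun a one) : pth _ _)) N ->
  exists2 U, open_nbhs (path_fun a one) U &
    forall y (b : pth (path_fun a one) y), range b `<=` U -> N (extend_path b).
Proof.
pose F : set_system (based_path R x0) :=
  filter_from [set U | open_nbhs (path_fun a one) U]
    (fun U => [set c | exists y (b : pth (path_fun a one) y),
       range b `<=` U /\ c = extend_path b]).
have FF : Filter F.
  apply: filter_from_filter; first by exists setT; exact: open_nbhsT.
  move=> U V aU aV; exists (U `&` V); first exact: open_nbhsI.
  by move=> c [y [b [bUV ->]]]; split; exists y, b; split=> // z /bUV[].
have Fa : F --> extend_path (cst (path_fun a one) : pth _ _).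
  apply/compact_open_sub_cvgP => K O cK oO aKO.
  have [[t [Kt t2]]|noK] := pselect (exists t, K t /\ ~ (ival t <= 2^-1)%R).
    exists O.
      split=> //; apply: aKO; exists t => //.
      by rewrite /= /mk_path /= /concat; case: ifP.
    move=> _ [y [b [bO ->]]] _ [s Ks <-] /=; rewrite /concat.
    case: ifP => s2; last by apply: bO; eexists.
    by apply: aKO; exists s => //; rewrite /= /mk_path /= /concat s2.
  exists setT; first exact: open_nbhsT.
  move=> _ [y [b [_ ->]]] _ [s Ks <-].
  have s2 : (ival s <= 2^-1)%R by apply: contrapT => s2; apply: noK; exists s.
  apply: aKO; exists s => //.
  by rewrite /= /concat s2.
by move=> /Fa[U aU UN]; exists U => // y b bU; apply: UN; exists y, b.
Qed.

Lemma loop_path1 (x : X) (g : loop_space R x) : loop_path g one = x.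
Proof. by rewrite /loop_path /= circle_exp_one loop_base. Qed.

(** With near_mk_loop this identifies the space of loops, maps on the circle,
    with the subspace of the based paths that are closed. *)
Definition based_loop (g : loop_space R x0) : based_path R x0 :=
  mk_based_path (@loop_path_continuous _ _ _ g) (loop_path0 g).

Lemma based_loop_continuous : continuous based_loop.
Proof.
move=> g; have FF : Filter (nbhs g) by exact: nbhs_filter.
apply/(@compact_open_sub_cvgP I X _ _ _ (fmap_filter _ FF)) => K O cK oO gKO.
have cEK : compact (@circle_exp R @` K).
  apply: continuous_compact => //.
  exact/continuous_subspaceT/circle_exp_continuous.
have gEKO : loop_fun g @` (@circle_exp R @` K) `<=` O.
  by move=> _ [_ [t Kt <-] <-]; apply: gKO; exists t.
have : \forall h \near g, loop_fun h @` (@circle_exp R @` K) `<=` O.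
  by have /compact_open_sub_cvgP := @cvg_id _ (nbhs g); apply.
apply: filterS => h hO _ [t Kt <-].
by apply: hO; exists (circle_exp t) => //; exists t.
Qed.

Lemma mk_loop_continuous (x : X) (f : I -> X) : continuous f -> f zero = x ->
  f one = x -> continuous (f \o @circle_arg R : S1 -> X).
Proof.
by move=> cf f0 f1; apply: continuous_circle; rewrite comp_circle_arg // f0.
Qed.

Lemma mk_loop_base (x : X) (f : I -> X) : f zero = x -> f one = x ->
  (f \o @circle_arg R) (circle_base R) = x.
Proof.
move=> f0 f1; rewrite -circle_exp_zero -[LHS]/((f \o _ \o @circle_exp R) zero).
by rewrite comp_circle_arg // f0.
Qed.

Definition mk_loop (x : X) (f : I -> X) (cf : continuous f)
    (f0 : f zero = x) (f1 : f one = x) : loop_space R x :=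
  exist (fun g => g \in [set g : {compact-open, S1 -> X} |
      continuous (g : S1 -> X) /\ g (circle_base R) = x])
    _ (mem_set (conj (mk_loop_continuous cf f0 f1) (mk_loop_base f0 f1))).

Lemma loop_path_mk_loop (x : X) (f : I -> X) (cf : continuous f)
    (f0 : f zero = x) (f1 : f one = x) : loop_path (mk_loop cf f0 f1) = f.
Proof. by apply: comp_circle_arg; rewrite f0. Qed.

(** The preimage in [0, 1] of a compact part K of the circle is compact, so that a
    subbasic condition on maps on the circle is one on paths. *)
Lemma near_mk_loop (f0 : based_path R x0) (e0 : path_fun f0 one = x0)
    (N : set (loop_space R x0)) :
  nbhs (mk_loop (@path_fun_continuous _ _ _ f0) (path_fun0 f0) e0) N ->
  \forall f \near f0, forall e : path_fun f one = x0,
    N (mk_loop (@path_fun_continuous _ _ _ f) (path_fun0 f) e).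
Proof.
pose G : set_system (loop_space R x0) := [set M | \forall f \near f0,
  forall e : path_fun f one = x0,
    M (mk_loop (@path_fun_continuous _ _ _ f) (path_fun0 f) e)].
have F0 : Filter (nbhs f0) by exact: nbhs_filter.
have GF : Filter G.
  split; first by apply: (@filterS _ _ F0 setT) => //; exact: filterT.
    by move=> M M' GM GM'; apply: (@filterS2 _ _ F0 _ _ _ _ GM GM') => f Mf M'f e; split.
  by move=> M M' MM' GM; apply: (@filterS _ _ F0 _ _ _ GM) => f Mf e; exact/MM'/Mf.
suff Gf : G --> mk_loop (@path_fun_continuous _ _ _ f0) (path_fun0 f0) e0 by exact: Gf.
apply/compact_open_sub_cvgP => K O cK oO fKO.
have cEK : compact (@circle_exp R @^-1` K).
  apply: (subclosed_compact _ unit_interval_compact) => //.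
  move/continuous_closedP : (@circle_exp_continuous R); apply.
  exact: compact_closed (@circle_hausdorff R) cK.
have : \forall f \near f0, path_fun f @` (@circle_exp R @^-1` K) `<=` O.
  apply: near_path_fun => // _ [t Kt <-]; apply: fKO; exists (circle_exp t) => //.
  by rewrite -[in RHS](loop_path_mk_loop (@path_fun_continuous _ _ _ f0) (path_fun0 f0) e0).
apply: filterS => f fO e _ [z Kz <-]; apply: fO.
by exists (circle_arg z) => //=; rewrite circle_argK.
Qed.

End BasedPaths.

(** * Paths near a given path in a small loop transfer space *)

Section Tracking.
Local Open Scope classical_set_scope.
Local Open Scope path_scope.
Context {R : realType} {X : topologicalType} {x0 : X}.
Notation I := (unit_interval R).
Notation pth x y := {path I from x to y in X}.

(** Leaves the circle once and for all: from here on loops are closed paths, to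
    which the groupoid laws apply. *)
Lemma slt_path : slt_space R X ->
  forall (x y : X) (alpha : pth x y) (U : set X), nbhs x U ->
  exists2 V, nbhs y V & forall beta : pth y y, range beta `<=` V ->
    exists2 gamma : pth x x, range gamma `<=` U &
      gamma =h (alpha * beta) * alpha^-1.
Proof.
move=> slt x y alpha U xU; have [V [yV VU]] := slt x y alpha U xU.
exists V => // beta bV.
pose lb := mk_loop (@cts_fun _ _ beta) path_zero path_one.
have [|g [gU gE]] := VU lb.
  by move=> _ [z _ <-]; apply: bV; exists (circle_arg z).
exists (mk_path (@loop_path_continuous R X x g) (loop_path0 g) (loop_path1 g)).
  by move=> _ [t _ <-]; apply: gU; exists (circle_exp t).
by move: gE; rewrite loop_path_mk_loop.
Qed.

Definition bseg (a : based_path R x0) (s t : I) :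
    pth (path_fun a s) (path_fun a t) :=
  seg (@path_fun_continuous _ _ _ a) s t.

Lemma range_bseg (a : based_path R x0) (s t : I) (A : set X) :
  path_fun a @` range (lin s t) `<=` A -> range (bseg a s t) `<=` A.
Proof. by move=> aA _ [u _ <-]; apply: aA; exists (lin s t u). Qed.

(** Constant; it only reconciles the types, as both paths start at x0 but not
    by conversion. *)
Definition basepoint_path (a c : based_path R x0) :
    pth (path_fun a zero) (path_fun c zero) :=
  mk_path (fun t => @cst_continuous I X x0 t)
    (esym (path_fun0 a)) (esym (path_fun0 c)).

(** The statement propagated along [0, 1]. At t = 1, with O = U, it says that c is
    a followed by a path in U. Before that, returning to a over d and completing
    the journey along a makes the part of c already travelled comparable with the
    whole of a, the difference being a loop in the fixed set U. The short path d
    must be controllable at will by O: the V in which it has to lie changes from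
    one step of the propagation to the next. *)
Definition tracked (a : based_path R x0) (U : set X) (t : I) : Prop :=
  forall O, nbhs (path_fun a t) O -> \forall c \near a,
    exists (d : pth (path_fun a t) (path_fun c t))
           (g : pth (path_fun a one) (path_fun a one)),
      [/\ range d `<=` O, range g `<=` U &
          basepoint_path a c * (bseg c zero t * (d^-1 * bseg a t one))
            =h bseg a zero one * g].

Lemma tracked0 (a : based_path R x0) (U : set X) :
  nbhs (path_fun a one) U -> tracked a U zero.
Proof.
move=> aU O aO; have F0 : Filter (nbhs a) by exact: nbhs_filter.
apply: (@filterS _ _ F0 setT); last exact: filterT.
move=> c _; exists (basepoint_path a c), (cst (path_fun a one)); split.
- move=> _ [t _ <-]; apply: nbhs_singleton.
  by rewrite -[basepoint_path a c t]/x0 -(path_fun0 a).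
- by move=> _ [t _ <-]; exact: nbhs_singleton.
- rewrite pcomp1 /bseg pcomp_seg_refl -pcompA pcomppV pcomp1p; reflexivity.
Qed.

(** Let V be small enough at time t for loops in V to be transferred along a to
    loops in U at the end of a, and let a stay in V during the time J. To move from
    s to s' in J, close the pieces of a and c between s and s' with the short paths
    d at s and d' at s': this makes a loop in V, based at the point of a at time t.
    Its transfer g' accounts for the difference between the two tracking
    relations, so that g becomes g followed by g'. *)
Lemma tracked_step (a : based_path R x0) (U V : set X) (t : I) (J : set I) :
  locally_path_connected R X ->
  (forall beta : pth (path_fun a t) (path_fun a t), range beta `<=` V ->
    exists2 gamma : pth (path_fun a one) (path_fun a one), range gamma `<=` U &
      gamma =h (bseg a one t * beta) * (bseg a one t)^-1) ->
  open V -> J t -> path_fun a @` J `<=` V ->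
  (forall s s', J s -> J s' -> range (lin s s') `<=` J) ->
  forall s s', J s -> J s' -> tracked a U s -> tracked a U s'.
Proof.
move=> lpc sltV oV Jt aJV Jconv s s' Js Js' tr O aO.
have aV r : J r -> V (path_fun a r) by move=> Jr; apply: aJV; exists r.
have Jlin r r' : J r -> J r' -> path_fun a @` range (lin r r') `<=` V.
  by move=> Jr Jr' _ [u ru <-]; apply/aV/(Jconv _ _ Jr Jr').
have segV r r' : J r -> J r' -> range (bseg a r r') `<=` V.
  by move=> Jr Jr'; apply: range_bseg; exact: Jlin.
have lin_compact r r' : compact (range (lin r r' : I -> I)).
  apply: continuous_compact; last exact: unit_interval_compact.
  exact/continuous_subspaceT/lin_continuous.
(* d' must lie in O, and also in V for the loop to be transferable *)
have [|O' [[oO' aO'] O'OV O'pc]] := lpc (path_fun a s') (O `&` V).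
  by apply: filterI => //; exact/open_nbhs_nbhs/(conj oV)/aV.
have nearO' : \forall c \near a, path_fun c @` [set s'] `<=` O'.
  by apply: near_path_fun => // [|_ [_ -> <-]]; first exact: compact_set1.
have nearV : \forall c \near a, path_fun c @` range (lin s s') `<=` V.
  by apply: near_path_fun => //; exact: Jlin.
have nearT := tr V (open_nbhs_nbhs (conj oV (aV s Js))).
have F0 : Filter (nbhs a) by exact: nbhs_filter.
apply: (@filterS3 _ _ F0 _ _ _ _ _ nearO' nearV nearT).
move=> c cO' cV [d [g [dV gU E]]].
have [|d' d'O'] := O'pc _ (path_fun c s') aO'.
  by apply: cO'; exists s'.
have d'V : range d' `<=` V by move=> x /d'O'/O'OV[].
have [|g' g'U E'] := sltV
  (bseg a t s * (d * (bseg c s s' * (d'^-1 * bseg a s' t)))).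
  apply: range_pcomp; first exact: segV.
  apply: range_pcomp => //; apply: range_pcomp; first exact: range_bseg.
  by apply: range_pcomp; [exact: range_prev|exact: segV].
exists d', (g * g'); split.
- by move=> x /d'O'/O'OV[].
- exact: range_pcomp.
(* Substituting E and E', the path runs from s to 1 along a, back to t and on to
   s, which cancels; then the inverse of d meets d. *)
- rewrite -(pcompA (bseg a zero one)) -E E' /bseg prev_seg !pcompA !pcomp_segA.
  rewrite pcomp_seg_refl pcompKp.
  rewrite pcomp_segA pcomp_seg; reflexivity.
Qed.

(** Each t has an interval of times around it during which a stays in a
    transferable V; tracking is thus locally constant in time. *)
Lemma tracked1 (a : based_path R x0) (U : set X) :
  locally_path_connected R X -> slt_space R X ->
  nbhs (path_fun a one) U -> tracked a U one.
Proof.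
move=> lpc slt aU; apply: (@locally_constant_unit_interval R (tracked a U));
  last exact: tracked0.
move=> t; have [V aV sltV] := slt_path slt (bseg a one t) aU.
have ca := @path_fun_continuous _ _ _ a.
have : nbhs (ival t) ((path_fun a \o clamp) @^-1` V^°).
  have : {for ival t, continuous (path_fun a \o clamp)}.
    by apply: continuous_comp; [exact: clamp_continuous|exact: ca].
  by apply; rewrite /= ivalK; exact: nbhs_interior.
move=> /nbhs_ballP[e /= e0 eV].
pose J : set I := [set s | ball (ival t) e (ival s)].
exists J; split.
  by apply: (@ival_continuous R t (ball (ival t) e)); exact: nbhsx_ballx.
apply: (@tracked_step a U V^° t).
- exact: lpc.
- by move=> beta bV; apply: sltV => x /bV; exact: interior_subset.
- exact: open_interior.
- exact: ballxx.
- by move=> _ [s Js <-]; have := eV _ Js; rewrite /= ivalK.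
- move=> s s'; rewrite /J /= /ball /= => Js Js' _ [u _ <-] /=.
  rewrite ival_lin; have [u0 u1] := (ival_ge0 u, ival_le1 u).
  move: Js Js'; rewrite !ltr_distl => /andP[? ?] /andP[? ?]; apply/andP.
  by have [ss'|s's] := leP (ival s) (ival s'); split; nra.
Qed.

(** The heart of the comparison. At time 1 the short path d of the tracking
    relation lies in U, so the loop g in U followed by d is the whisker. *)
Lemma extend_path_near (a : based_path R x0) (U : set X) :
  locally_path_connected R X -> slt_space R X -> nbhs (path_fun a one) U ->
  \forall c \near a, whisker_ball a U (path_class c).
Proof.
move=> lpc slt aU; have F0 : Filter (nbhs a) by exact: nbhs_filter.
apply: (@filterS _ _ F0 _ _ _ (tracked1 lpc slt aU aU)) => c [d [g [dU gU E]]].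
exists (path_fun c one), (g * d); split; first exact: range_pcomp.
apply/path_class_eqP.
have Ecd : basepoint_path a c * bseg c zero one =h bseg a zero one * (g * d).
  rewrite -pcompA -E !pcompA.
  rewrite pcomp_seg_refl pcompVp pcomp1; reflexivity.
have {}Ecd : path_homotopic (concat (cst x0) (path_fun c \o lin zero one))
    (concat (path_fun a \o lin zero one) (g * d)) := Ecd.
rewrite !lin01 in Ecd.
apply: path_homotopic_trans Ecd; apply: path_homotopic_sym.
rewrite -{1}(path_fun0 c); apply: path_homotopic_unitl.
exact: path_fun_continuous.
Qed.
End Tracking.

(** * Comparison of the topologies *)

Section Comparison.
Local Open Scope classical_set_scope.
Context {R : realType} {X : topologicalType} {x0 : X}.
Notation I := (unit_interval R).

Lemma path_class_extend_cst (a : based_path R x0) :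
  path_class (extend_path (cst (path_fun a one) : {path I from _ to _ in X}))
    = path_class a.
Proof.
by apply/path_class_eqP/path_homotopic_unitr; exact: path_fun_continuous.
Qed.

Lemma whisker_ball_end (a c : based_path R x0) (U : set X) :
  whisker_ball a U (path_class c) -> U (path_fun c one).
Proof.
move=> [y [b [bU /path_class_eqP/path_homotopic_ends[_ ->]]]].
by apply: bU; exists one => //; exact/esym/concat1.
Qed.

(** The class of a is also that of a * const, whose neighborhoods contain all
    a * b with b in some U; this is where near_extend_path applies. *)
Lemma open_top_wh (W : set (path_classes R x0)) :
  open (W : set (path_classes_top R x0)) ->
  open (W : set (path_classes_wh R x0)).
Proof.
move=> /open_path_classes_top oW; apply/open_path_classes_wh => p Wp.
have pE : path_class (repr p) = p by rewrite /path_class reprK.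
have [|U aU UW] := @near_extend_path _ _ _ (repr p)
    (@path_class R X x0 @^-1` W).
  by apply: open_nbhs_nbhs; split=> //; rewrite /= path_class_extend_cst pE.
exists (repr p), U; split=> //.
  by have := @whisker_ball_refl _ _ _ (repr p) U aU.2; rewrite pE.
by move=> _ [y [b [bU ->]]]; exact: UW.
Qed.

Lemma open_wh_top (W : set (path_classes R x0)) :
  locally_path_connected R X -> slt_space R X ->
  open (W : set (path_classes_wh R x0)) ->
  open (W : set (path_classes_top R x0)).
Proof.
move=> lpc slt /open_path_classes_wh oW; apply/open_path_classes_top.
rewrite openE => c /oW[a [U [[oU _] aUc aUW]]].
have cU := whisker_ball_end aUc.
have F0 : Filter (nbhs c) by exact: nbhs_filter.
have cN := extend_path_near lpc slt (open_nbhs_nbhs (conj oU cU)).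
apply: (@filterS _ _ F0 _ _ _ cN) => c' cUc'; apply: aUW.
exact: (whisker_ball_sub aUc (@subset_refl _ U)) cUc'.
Qed.

Lemma to_pi1_mk_loop (f : based_path R x0) (e : path_fun f one = x0) (q : pi1 R x0) :
  path_class f = \val q ->
  to_pi1 (mk_loop (@path_fun_continuous _ _ _ f) (path_fun0 f) e) = q.
Proof.
move=> fq; apply: val_inj; rewrite -fq; apply/path_class_eqP.
change (path_homotopic
  (loop_path (mk_loop (@path_fun_continuous _ _ _ f) (path_fun0 f) e))
  (path_fun f)).
rewrite loop_path_mk_loop; exact/path_homotopic_refl/path_fun_continuous.
Qed.

(** A whisker-open set of classes is open for the quotient topology, and the
    latter pulls back continuously to loops. *)
Lemma open_pi1_wh_top (W : set (pi1 R x0)) :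
  locally_path_connected R X -> slt_space R X ->
  open (W : set (pi1_wh R x0)) -> open (W : set (pi1_top R x0)).
Proof.
move=> lpc slt /open_pi1_wh[A oA ->]; apply/open_pi1_top.
have /open_path_classes_top oA' := open_wh_top lpc slt oA.
have /continuousP/(_ _ oA') := @based_loop_continuous R X x0; exact.
Qed.

(** The subspace topology asks for an open set of all path classes that traces W
    on the fundamental group: it is the union of the whisker balls whose loops lie
    in W. That they cover W is the argument of open_top_wh, in which a path
    a * b representing a loop class is closed, hence is a map on the circle. *)
Lemma open_pi1_top_wh (W : set (pi1 R x0)) :
  open (W : set (pi1_top R x0)) -> open (W : set (pi1_wh R x0)).
Proof.
move=> /open_pi1_top oW; apply/open_pi1_wh.
exists [set p | exists a U, [/\ open_nbhs (path_fun a one) U,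
    whisker_ball a U p & forall q : pi1 R x0, whisker_ball a U (\val q) -> W q]].
  apply/open_path_classes_wh => p [a [U [aU aUp UW]]].
  by exists a, U; split=> // q aUq; exists a, U.
apply/seteqP; split=> q; last by case=> a [U [_ aUq]]; apply.
rewrite -(pi1_reprK q); set g := pi1_repr q => Wg.
pose a := based_loop g.
have a1 : path_fun a one = x0 by exact: loop_path1.
pose ac := extend_path (cst (path_fun a one) : {path I from _ to _ in X}).
have ac1 : path_fun ac one = x0 by rewrite -[RHS]a1; exact: concat1.
have [|U aU UN] := @near_extend_path _ _ _ a [set f | forall e : path_fun f one = x0,
    W (to_pi1 (mk_loop (@path_fun_continuous _ _ _ f) (path_fun0 f) e))].
  apply: (@near_mk_loop R X x0 ac ac1 [set h | W (to_pi1 h)]).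
  apply: open_nbhs_nbhs; split; first exact: oW.
  rewrite /= (to_pi1_mk_loop _ (q := to_pi1 g)) //; exact: path_class_extend_cst.
exists a, U; split=> //; first exact: (whisker_ball_refl aU.2).
move=> r [y [b [bU rE]]].
have e : path_fun (extend_path b) one = x0.
  have [h _ hE] := set_mem (svalP r).
  have /path_class_eqP/path_homotopic_ends[_ <-] := etrans hE rE.
  exact: loop_path1.
by rewrite -(to_pi1_mk_loop e (esym rE)); exact: UN.
Qed.

End Comparison.

Local Open Scope classical_set_scope.

Theorem theorem4p12 (R : realType) (X : topologicalType) (x0 : X) :
  peano_space R X -> slt_space R X ->
  (forall W : set (pi1 R x0),
     open (W : set (pi1_wh R x0)) <-> open (W : set (pi1_top R x0))) /\
  (forall W : set (path_classes R x0),
     open (W : set (path_classes_top R x0)) <->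
     open (W : set (path_classes_wh R x0))).
Proof.
move=> [_ lpc] slt; split=> W; split.
- exact: open_pi1_wh_top.
- exact: open_pi1_top_wh.
- exact: open_top_wh.
- exact: open_wh_top.
Qed.
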